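(* There exists a set $H\subset\mathbb{R}^2$ which is countably infinite, bounded and not contained in a line, such that no line in $\mathbb{R}^2$ meets $H$ in exactly two points (equivalently, every line through two distinct points of $H$ contains a third point of $H$). *)

(* Defs.v *)
From HB Require Import structures.
From mathcomp Require Import all_boot all_order all_algebra.
From mathcomp Require Import all_classical all_reals all_analysis.
Import Order.TTheory GRing.Theory Num.Theory.
Import numFieldNormedType.Exports.

Set Implicit Arguments.
Unset Strict Implicit.
Unset Printing Implicit Defensive.

Local Open Scope classical_set_scope.
Local Open Scope ring_scope.

Definition is_line (R : realType) (L : set (R * R)) : Prop :=
  exists a v : R * R, v != 0 /\ L = [set a + t *: v | t in [set: R]].

(* Main.v *)
Require Import Defs.
From HB Require Import structures.
From mathcomp Require Import all_boot all_order all_algebra.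
From mathcomp Require Import all_classical all_reals all_analysis.
From mathcomp Require Import ring lra.
Import Order.TTheory GRing.Theory Num.Theory.
Import numFieldNormedType.Exports.

Set Implicit Arguments.
Unset Strict Implicit.
Unset Printing Implicit Defensive.

Local Open Scope classical_set_scope.
Local Open Scope card_scope.
Local Open Scope ring_scope.

(** Take for [H] the rational points of the unit ball of the sup norm: [H] is
    stable under midpoints, and the midpoint of two distinct points is a third
    point of the line joining them. *)

(** The image of the rationals in [R] is closed under averaging, balls are convex and lines are
    convex. So a line through two distinct points of [rational_ball] contains their midpoint, which
    again lies in [rational_ball] ([rational_ball_midpoint], [line_midpoint]) and differs from both
    endpoints. The set is countable inside a copy of the rational plane, infinite because of the
    points with coordinates [1/(n+1)] and [0], and not collinear because it contains the origin and
    both unit vectors. *)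

Lemma card_II2_set2 (T : pointedType) (A : set T) :
  A #= `I_2 -> exists p q, p <> q /\ A = [set p; q].
Proof.
rewrite card_eq_sym => /card_set_bijP[f [ffun finj fsurj]].
exists (f 0%N), (f 1%N); split.
  by move=> /(finj _ _ (mem_set (isT : `I_2 0%N)) (mem_set (isT : `I_2 1%N))).
apply/seteqP; split=> [x /fsurj[[|[|k]] //= _ <-]|x [->|->]]; first by left.
- by right.
- exact: ffun.
- exact: ffun.
Qed.

Section Midpoint.
Variable R : realType.
Implicit Types (p q : R * R) (L : set (R * R)).

Definition midpoint p q : R * R := 2^-1 *: (p + q).

Lemma midpoint_neql p q : p <> q -> midpoint p q <> p.
Proof.
(* By contraposition: if the midpoint is [p], then each coordinate of [q] equals that of [p]. *)
case: p q => [p1 p2] [q1 q2] + [e1 e2]; apply.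
rewrite /= !/(_ *: _) /= in e1 e2.
by congr pair; lra.
Qed.

Lemma midpointC p q : midpoint p q = midpoint q p.
Proof. by rewrite /midpoint addrC. Qed.

Lemma midpoint_neqr p q : p <> q -> midpoint p q <> q.
Proof. by move=> /nesym; rewrite midpointC; exact: midpoint_neql. Qed.

Lemma line_midpoint L p q : is_line L -> L p -> L q -> L (midpoint p q).
Proof.
(* Parametrization is affine, so the midpoint has the average parameter. *)
move=> [a [v [_ ->]]] [t _ <-] [s _ <-]; exists (2^-1 * (t + s)) => //.
rewrite /midpoint; case: a v => [a1 a2] [v1 v2].
by congr pair; rewrite /= !/(_ *: _) /=; field.
Qed.

Definition rational_ball : set (R * R) :=
  (range ratr `*` range ratr) `&` [set p | `|p| <= 1].

Lemma rational_ball_midpoint p q :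
  rational_ball p -> rational_ball q -> rational_ball (midpoint p q).
Proof.
have half (x y : R) : range ratr x -> range ratr y ->
    range ratr (2^-1 * (x + y)).
  move=> [a _ <-] [b _ <-]; exists (2^-1 * (a + b)) => //.
  by rewrite rmorphM rmorphD fmorphV rmorph_nat.
move=> [[p1 p2] /= np] [[q1 q2] /= nq]; split; first by split; exact: half.
(* Convexity of the ball reduces to [|p + q| <= 2], the triangle inequality. *)
rewrite /midpoint /= normrZ gtr0_norm ?invr_gt0// ler_pdivrMl// mulr1.
by rewrite (le_trans (ler_normD _ _)) // lerD.
Qed.

Lemma countable_rational_ball : countable rational_ball.
Proof.
apply: (@sub_countable _ _ _ (range ratr `*` range ratr)).
  by apply: subset_card_le => p [].
have cQ : countable (range (ratr : rat -> R)).
  exact/(sub_countable (card_image_le _ _))/countableP.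
exact: countableX.
Qed.

Lemma infinite_rational_ball : infinite_set rational_ball.
Proof.
apply/infiniteP; pose f n : R * R := (n.+1%:R^-1, 0).
have finj : injective f by move=> m n [/invr_inj/eqP]; rewrite eqr_nat => /eqP[].
rewrite -(card_le_eql (inj_card_eq (in2W finj))); apply: subset_card_le.
move=> _ [n _ <-]; split; first split => /=.
- by exists n.+1%:R^-1; rewrite ?fmorphV ?rmorph_nat.
- by exists 0; rewrite ?raddf0.
rewrite /= prod_normE ge_max /= normr0 ler01 andbT ger0_norm ?invr_ge0//.
by rewrite invf_le1 ?ler1n.
Qed.

Lemma bounded_rational_ball : bounded_set rational_ball.
Proof.
(* Boundedness means that every large enough [M] is a bound; the threshold is the radius 1. *)
by exists 1; split=> [|M M1 p [_ /=] /le_trans]; [|apply; exact: ltW].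
Qed.

Lemma rational_ball_not_collinear L : is_line L -> ~ (rational_ball `<=` L).
Proof.
(* Pairs of booleans encode the corners of the unit square; three of them are used. *)
have ball01 (b c : bool) : rational_ball (b%:R, c%:R).
  split; first by split; [exists b%:R | exists c%:R]; rewrite ?ratr_nat.
  by rewrite /= prod_normE ge_max /= !normr_nat !lern1 !leq_b1.
move=> [[a1 a2] [[v1 v2] [_ ->]]] HL.
have [t _ [t1 t2]] := HL _ (ball01 false false).
have [s _ [s1 s2]] := HL _ (ball01 true false).
have [u _ [u1 u2]] := HL _ (ball01 false true).
rewrite /= !/(_ *: _) /= in t1 t2 s1 s2 u1 u2.
(* Both [(1, 0)] and [(0, 1)] are differences of points of [L], hence multiples of [v], so their
   determinant vanishes; computed directly it is 1. *)
have : ((s - t) * v1) * ((u - t) * v2) = ((s - t) * v2) * ((u - t) * v1).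
  by ring.
have -> : (s - t) * v1 = 1 by lra.
have -> : (u - t) * v2 = 1 by lra.
have -> : (s - t) * v2 = 0 by lra.
by lra.
Qed.

End Midpoint.

Theorem theorem3 (R : realType) :
  exists H : set (R * R),
    [/\ H #= [set: nat],
        bounded_set H,
        ~ (exists2 L : set (R * R), is_line L & H `<=` L),
        (forall L : set (R * R), is_line L -> ~ (H `&` L #= `I_2)) &
        (forall (L : set (R * R)) (p q : R * R),
           is_line L -> H p -> H q -> p <> q -> L p -> L q ->
           exists r : R * R, [/\ H r, L r, r <> p & r <> q])].
Proof.
(* This is the last conjunct, and it also excludes lines with exactly two points: the third point
   would have to be [p] or [q]. *)
have third L p q : is_line L -> rational_ball p -> rational_ball q ->
    p <> q -> L p -> L q ->
    exists r : R * R, [/\ rational_ball r, L r, r <> p & r <> q].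
  move=> lL Hp Hq pq Lp Lq; exists (midpoint p q); split.
  - exact: rational_ball_midpoint.
  - exact: line_midpoint.
  - exact: midpoint_neql.
  - exact: midpoint_neqr.
exists (@rational_ball R); split => //.
- exact: eq_card_nat (@countable_rational_ball R) (@infinite_rational_ball R).
- exact: bounded_rational_ball.
- by move=> [L /rational_ball_not_collinear].
- move=> L lL /card_II2_set2[p [q [pq HL]]].
  have [Hp Lp] : (@rational_ball R `&` L) p by rewrite HL; left.
  have [Hq Lq] : (@rational_ball R `&` L) q by rewrite HL; right.
  have [r [Hr Lr rp rq]] := third L p q lL Hp Hq pq Lp Lq.
  by have : (@rational_ball R `&` L) r by []; rewrite HL => -[].
Qed.
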